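(* Let $\mathcal{M}$ be a finite MDP with reward function $\mathcal{R}$, let $N\in\mathbb{N}$, let $p$ be an atomic proposition, assume $s_0\in S_r$, and let $\overline{\mathcal{M}}'$, $\Xi(\overline{\mathcal{M}}')$ and $f_\epsilon$ ($\epsilon\ge0$) be as defined in the context. Then for any given $\overline{\epsilon}>0$ there exists $\epsilon>0$ such that $$\min_{\pi\in\Xi(\overline{\mathcal{M}}')} f_{\epsilon}(\pi)\ \leq\ \min_{\pi\in\Xi(\overline{\mathcal{M}}')} f_0(\pi)+\overline{\epsilon}.$$
   Context: MDP. $\mathcal{M}=(S,s_0,\mathcal{A},\mathcal{P},\mathcal{AP},\mathcal{L},\mathcal{R})$ with finite state set $S$, initial state $s_0$, finite action set $\mathcal{A}$, nonempty sets $\mathcal{A}(s)\subseteq\mathcal{A}$ of available actions, transition probabilities $\mathcal{P}_{s,a,s'}\in[0,1]$ with $\sum_{s'}\mathcal{P}_{s,a,s'}=1$ for $a\in\mathcal{A}(s)$, atomic propositions $\mathcal{AP}$, labeling $\mathcal{L}:S\to 2^{\mathcal{AP}}$, reward $\mathcal{R}:S\times\mathcal{A}\to\mathbb{R}$. Policies. A decision rule assigns to each state $s$ a probability distribution $d(s,\cdot)$ on $\mathcal{A}(s)$. An ($\infty$-stage) policy is a sequence $\pi=(d_1,d_2,\ldots)$ of decision rules; $\Pi(\cdot)$ is the set of all such policies of an MDP. The process starts in the initial state at stage $1$. Reachability. Let $\varphi=\lozenge p$ (''eventually a state labeled by $p$ is visited''). $B\subseteq S$ is the set of states $s$ with $p\in\mathcal{L}(s)$;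 $S_0\subseteq S$ is the set of states from which $B$ is reached with probability $0$ under every policy; $S_r=S\setminus(B\cup S_0)$. Cost of control. With $\overline{V}_{N+1}\equiv 0$, define for $n=N,N-1,\ldots,1$: $\overline{Q}_n(s,a)=\mathcal{R}(s,a)+\sum_{s'\in S}\mathcal{P}_{s,a,s'}\overline{V}_{n+1}(s')$ and $\overline{V}_n(s)=\max_{a\in\mathcal{A}(s)}\overline{Q}_n(s,a)$. Expanded MDP. $\overline{\mathcal{M}}$ has state set $\overline{S}=S\times\{1,\ldots,N\}$, initial state $\overline{s}_0=(s_0,1)$, actions $\mathcal{A}((s,n))=\mathcal{A}(s)$, label $\overline{\mathcal{L}}((s,n))=\mathcal{L}(s)$, and transition probability $\overline{\mathcal{P}}_{(s,n),a,(s',n')}=\mathcal{P}_{s,a,s'}$ if ($n\le N-1$ and $n'=n+1$) or ($n=N$ and $n'=1$), and $0$ otherwise. Put $\overline{B}=B\times\{1,\ldots,N\}$, $\overline{S}_0=S_0\times\{1,\ldots,N\}$, $\overline{S}_r=S_r\times\{1,\ldots,N\}$. $\overline{\mathcal{M}}'$ is obtained from $\overline{\mathcal{M}}$ by making all states of $\overline{B}\cup\overline{S}_0$ absorbing. For $\epsilon\ge 0$ let $\underline{\phi}^{\epsilon}((s,n),a)=\overline{V}_n(s)-\overline{Q}_n(s,a)+\epsilon$ if $(s,n)\in\overline{S}_r$ and $a\in\mathcal{A}(s)$, and $0$ otherwise. $\Xi(\overline{\mathcal{M}}')$ is the set of policies $\pi\in\Pi(\overline{\mathcal{M}}')$ that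 maximize the probability $\mathrm{Pr}^{\pi}(\overline{s}_0\models\lozenge p)$ of reaching $\overline{B}$ from $\overline{s}_0$. For $\epsilon\ge 0$ and $\pi\in\Xi(\overline{\mathcal{M}}')$, $f_\epsilon(\pi)=\mathbb{E}^{\pi}_{\overline{s}_0}\big[\sum_{t=1}^\infty\underline{\phi}^{\epsilon}(S_t,A_t)\big]$, where $(S_t,A_t)$ is the state-action pair of $\overline{\mathcal{M}}'$ at stage $t$. *)

(* Defs.v *)
From HB Require Import structures.
From mathcomp Require Import all_boot all_order all_algebra.
From mathcomp Require Import all_classical all_reals all_analysis.

Set Implicit Arguments.
Unset Strict Implicit.
Unset Printing Implicit Defensive.
Import Order.TTheory GRing.Theory Num.Theory.
Import numFieldNormedType.Exports.

Local Open Scope classical_set_scope.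
Local Open Scope ring_scope.

(* Infinite sequences over a finite type. The argument x0 only serves to make
   the type pointed, as measurable types have to be. *)
Definition seqs (T : finType) (x0 : T) : Type := nat -> T.

HB.instance Definition _ (T : finType) (x0 : T) := Choice.on (seqs x0).
HB.instance Definition _ (T : finType) (x0 : T) :=
  isPointed.Build (seqs x0) (fun=> x0).

Definition cylinder (T : finType) (x0 : T) (h : seq T) : set (seqs x0) :=
  [set om : seqs x0 | mkseq om (size h) = h].

Definition cylinders (T : finType) (x0 : T) : set (set (seqs x0)) :=
  range (@cylinder T x0).

Arguments cylinder {T} x0 h.
Arguments cylinders {T} x0.

Notation seq_space x0 := (g_sigma_algebraType (cylinders x0)).

Section seq_measure.
Variables (R : realType) (T : finType) (x0 : T) (w : seq T -> R).
Hypotheses (w_ge0 : forall h, 0 <= w h) (w_nil : w [::] = 1).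
Hypothesis w_rcons : forall h, \sum_x w (rcons h x) = w h.

Let before (x y : T) := (enum_rank y < enum_rank x)%N.

(* The points of [0, 1[ whose coded sequence starts with h form the interval
   [low [::] h, low [::] h + w h[; the intervals of the one-letter extensions
   of h partition that of h. *)
Let low := fix low (g h : seq T) : R :=
  if h is x :: h' then
    \sum_(y | before x y) w (rcons g y) + low (rcons g x) h'
  else 0.

Let low_rcons g h x :
  low g (rcons h x) = low g h + \sum_(y | before x y) w (rcons (g ++ h) y).
Proof.
elim: h g => [|z h IH] g /=; first by rewrite addr0 add0r cats0.
by rewrite IH addrA cat_rcons.
Qed.

Let inI (h : seq T) (u : R) := (low [::] h <= u) && (u < low [::] h + w h).

Let inI_rcons h x u : inI (rcons h x) u -> inI h u.
Proof.
rewrite /inI low_rcons cat0s => /andP[lu ur]; apply/andP; split.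
  by apply: le_trans lu; rewrite lerDl sumr_ge0.
apply: (lt_le_trans ur); rewrite -addrA lerD2l -[leRHS]w_rcons.
rewrite [leRHS](bigID (before x)) /= lerD2l (bigD1 x) ?/before ?ltnn//=.
by rewrite lerDl sumr_ge0.
Qed.

Let inI_disj h x y u : before x y -> inI (rcons h x) u ->
  inI (rcons h y) u -> False.
Proof.
rewrite /inI !low_rcons cat0s => yx /andP[lx _] /andP[_ ry].
have := lt_le_trans ry (le_refl _); apply/negP; rewrite -leNgt.
apply: le_trans lx; rewrite -addrA lerD2l.
rewrite [leRHS](bigID (before y)) /= lerD//.
  rewrite le_eqVlt; apply/orP; left; apply/eqP; apply: eq_bigl => z.
  by apply/idP/andP => [zy|[]//]; split=> //; exact: ltn_trans yx.
rewrite (bigD1 y) ?/before ?ltnn ?andbT//=.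
by rewrite lerDl sumr_ge0.
Qed.

Let inI_uniq h x y u : inI (rcons h x) u -> inI (rcons h y) u -> x = y.
Proof.
move=> ux uy; case: (ltngtP (enum_rank x) (enum_rank y)) => [xy|yx|].
- by case: (inI_disj xy uy ux).
- by case: (inI_disj yx ux uy).
- by move=> /val_inj/enum_rank_inj.
Qed.

Let inI_ex h u : inI h u -> exists x, inI (rcons h x) u.
Proof.
move=> /andP[lu ur].
pose up x := low [::] h + \sum_(y | ~~ before y x) w (rcons h y).
have exx : exists x, u < up x.
  have T0 : (0 < #|T|)%N by apply/card_gt0P; exists x0.
  have lt1 : (#|T|.-1 < #|T|)%N by rewrite prednK.
  exists (enum_val (Ordinal lt1)); rewrite /up.
  apply: (lt_le_trans ur); rewrite lerD2l -w_rcons.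
  rewrite le_eqVlt; apply/orP; left; apply/eqP; apply: eq_bigl => y.
  by rewrite /before enum_valK /= -leqNgt -ltnS prednK// ltn_ord.
pose P x := u < up x.
have [x0' Px0'] := exx.
case: (@arg_minnP T x0' P (fun x => enum_rank x) Px0') => x Px xmin.
exists x; rewrite /inI low_rcons cat0s; apply/andP; split; last first.
  apply: (lt_le_trans Px); rewrite /up -addrA lerD2l.
  rewrite (bigID (before x)) /= lerD//.
    rewrite le_eqVlt; apply/orP; left; apply/eqP; apply: eq_bigl => z.
    by rewrite andb_idl// /before => zx; rewrite -leqNgt ltnW.
  rewrite (big_pred1 x)// => z; rewrite /before -!leqNgt -eqn_leq.
  by rewrite (inj_eq val_inj) (inj_eq enum_rank_inj).
rewrite leNgt; apply/negP => ux.
case: (posnP (enum_rank x)) => [rx0|rx].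
  move: ux; rewrite big_pred0 ?addr0 ?ltNge ?lu// => y.
  by rewrite /before rx0.
have ltx : ((enum_rank x).-1 < #|T|)%N.
  by apply: leq_ltn_trans (ltn_ord (enum_rank x)); exact: leq_pred.
have := xmin (enum_val (Ordinal ltx)).
rewrite enum_valK /= -ltnS prednK// ltnn => H.
suff : P (enum_val (Ordinal ltx)) by move/H.
rewrite /P /up (eq_bigl (before x))// => y.
by rewrite /before enum_valK /= -leqNgt -ltnS prednK.
Qed.

Let step (h : seq T) (u : R) : T := odflt x0 [pick x | inI (rcons h x) u].

Let hist := fix hist (u : R) (n : nat) : seq T :=
  if n is m.+1 then rcons (hist u m) (step (hist u m) u) else [::].

Let code (u : R) : seq_space x0 := fun n => step (hist u n) u.

Let mkseq_code u n : mkseq (code u) n = hist u n.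
Proof. by elim: n => [//|n IH]; rewrite mkseqS IH. Qed.

Let inI_hist u n : inI [::] u -> inI (hist u n) u.
Proof.
move=> u01; elim: n => [//|n IH] /=; rewrite /step.
case: pickP => [//|no]; have [x] := inI_ex IH.
by rewrite no.
Qed.

Let inI_nil h u : inI h u -> inI [::] u.
Proof. by elim/last_ind: h => [//|h x IH] /inI_rcons/IH. Qed.

Let inI_histE u h : inI h u -> hist u (size h) = h.
Proof.
elim/last_ind: h => [//|h x IH] ux; rewrite size_rcons /= IH.
  rewrite /step; case: pickP => [y uy|/(_ x)]; last by rewrite ux.
  by rewrite (inI_uniq uy ux).
exact: inI_rcons ux.
Qed.

Let D : set R := `[0, 1[.

Let DE u : D u <-> inI [::] u.
Proof. by rewrite /D /inI /= in_itv /= w_nil add0r. Qed.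

Let mD : measurable (D : set (measurableTypeR R)).
Proof. exact: measurable_itv. Qed.

Let code_cyl h :
  D `&` code @^-1` cylinder x0 h = `[low [::] h, low [::] h + w h[%classic.
Proof.
apply/seteqP; split => u.
  move=> [/DE u01]; rewrite /cylinder /= mkseq_code => <-.
  by rewrite in_itv /=; exact: inI_hist.
rewrite /= in_itv /= => uh; split; first by apply/DE; exact: inI_nil uh.
by rewrite /cylinder /= mkseq_code inI_histE.
Qed.

Let mcode : measurable_fun D (code : measurableTypeR R -> seq_space x0).
Proof.
apply: (@measurability _ _ (measurableTypeR R) (seq_space x0) D code
  (cylinders x0) erefl).
by move=> _ [_ [h _ <-] <-]; rewrite code_cyl; exact: measurable_itv.
Qed.

Let mu : {measure set (measurableTypeR R) -> \bar R} :=
  @lebesgue_measure R.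
Let mu_itv (a b : R) : a <= b -> mu `[a, b[%classic = (b - a)%:E.
Proof.
move=> ab; have /= -> := lebesgue_measure_itv (Interval (BLeft a) (BLeft b)).
rewrite lte_fin; case: ltP => [_|ba]; first by rewrite EFinB.
by have -> : a = b; [apply/eqP; rewrite eq_le ab|rewrite subrr].
Qed.

Let law (A : set (seq_space x0)) : \bar R := mu (D `&` code @^-1` A).

Let law0 : law set0 = 0%E.
Proof. by rewrite /law preimage_set0 setI0 measure0. Qed.

Let law_ge0 A : (0 <= law A)%E. Proof. exact: measure_ge0. Qed.

Let law_additive : semi_sigma_additive law.
Proof.
move=> F mF tF mUF; rewrite /law preimage_bigcup setI_bigcupr.
apply: (@measure_semi_sigma_additive _ _ _ mu).
- by move=> n; exact: mcode.
- apply/trivIsetP => i j _ _ ij; apply/seteqP; split => [u|//].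
  move=> [[_ Fi] [_ Fj]].
  have /trivIsetP/(_ i j I I ij)/seteqP[FF _] := tF.
  by case: (FF (code u)).
- by rewrite -setI_bigcupr -preimage_bigcup; exact: mcode.
Qed.

#[local] HB.instance Definition _ :=
  isMeasure.Build _ _ _ law law0 law_ge0 law_additive.

Let law_setT : law setT = 1%E.
Proof.
by rewrite /law preimage_setT setIT mu_itv ?ler01// subr0.
Qed.

#[local] HB.instance Definition _ := Measure_isProbability.Build _ _ _ law law_setT.

Lemma ex_seq_measure :
  {P : probability (seq_space x0) R | forall h, P (cylinder x0 h) = (w h)%:E}.
Proof.
exists law => h; rewrite /= /law code_cyl mu_itv ?lerDl//.
by rewrite addrAC subrr add0r.
Qed.

End seq_measure.

Record mdp (R : realType) (AP : Type) := MDP {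
  state : finType;
  init : state;
  action : finType;
  avail : state -> {set action};
  trans : state -> action -> state -> R;
  label : state -> set AP;
  reward : state -> action -> R;
  avail_neq0 : forall s, avail s != finset.set0;
  trans_itv : forall s a s', 0 <= trans s a s' <= 1;
  trans_sum : forall s a, a \in avail s -> \sum_s' trans s a s' = 1 }.

Section policies.
Context {R : realType} {AP : Type} (M : mdp R AP).

Definition some_action (s : state M) : action M :=
  xchoose (set0Pn _ (avail_neq0 s)).

Lemma some_action_avail s : some_action s \in avail s.
Proof. exact: xchooseP. Qed.

Record decision_rule := DecisionRule {
  rule : state M -> action M -> R;
  rule_ge0 : forall s a, 0 <= rule s a;
  rule_sum : forall s, \sum_a rule s a = 1;
  rule_avail : forall s a, a \notin avail s -> rule s a = 0 }.

(* pi t is the decision rule of stage t + 1. *)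
Definition policy := nat -> decision_rule.

(* Probability that a run, whose first state has law nu, starts with the
   state-action pairs listed in h. *)
Fixpoint run_weight (pi : policy) (nu : state M -> R)
    (h : seq (state M * action M)%type) : R :=
  if h is (s, a) :: h' then
    nu s * rule (pi 0%N) s a *
    run_weight (fun t => pi t.+1) (fun s' => trans s a s') h'
  else 1.

Lemma run_weight_ge0 pi nu h : (forall s, 0 <= nu s) -> 0 <= run_weight pi nu h.
Proof.
elim: h pi nu => [//|[s a] h IH] pi nu nu0 /=.
rewrite !mulr_ge0// ?rule_ge0//; apply: IH => s'.
by have /andP[] := trans_itv s a s'.
Qed.

Lemma run_weight_rcons pi nu h : \sum_s nu s = 1 ->
  \sum_x run_weight pi nu (rcons h x) = run_weight pi nu h.
Proof.
elim: h pi nu => [|[s a] h IH] pi nu nu1 /=.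
  rewrite (eq_bigr (fun x => nu x.1 * rule (pi 0%N) x.1 x.2)); last first.
    by case=> s a _; rewrite mulr1.
  rewrite -(pair_bigA _ (fun s a => nu s * rule (pi 0%N) s a)) /= -[RHS]nu1.
  by apply: eq_bigr => s _; rewrite -mulr_sumr rule_sum mulr1.
rewrite -mulr_sumr; have [sa|sa] := boolP (a \in avail s).
  by rewrite IH// trans_sum.
by rewrite rule_avail// mulr0 !mul0r.
Qed.

(* A point of [runs] is the sequence of the pairs (S_t, A_t), that of stage
   t + 1 being at index t. *)
Definition runs := seq_space (init M, some_action (init M)).

Definition start (s : state M) : state M -> R := fun s' => (s' == s)%:R.

Lemma start_ge0 s s' : 0 <= start s s'.
Proof. by rewrite ler0n. Qed.

Lemma start_sum s : \sum_s' start s s' = 1.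
Proof. by rewrite (bigD1 s)//= big1 ?addr0 /start ?eqxx// => i /negbTE->. Qed.

Definition run_law (pi : policy) (s : state M) : probability runs R :=
  sval (ex_seq_measure (init M, some_action (init M))
    (fun h => run_weight_ge0 pi h (start_ge0 s))
    (erefl : run_weight pi (start s) [::] = 1)
    (fun h => run_weight_rcons pi h (start_sum s))).

Lemma run_law_cylinder pi s h :
  run_law pi s (cylinder _ h) = (run_weight pi (start s) h)%:E.
Proof. exact: (svalP (ex_seq_measure _ _ _ _)). Qed.

Definition reach_prob (pi : policy) (s : state M) (p : AP) : \bar R :=
  run_law pi s [set om : runs | exists t : nat, label (om t).1 p].

Definition total_cost (c : state M -> action M -> R) (pi : policy)
    (s : state M) : \bar R :=
  (\int[run_law pi s]_om \sum_(0 <= t <oo) (c (om t).1 (om t).2)%:E)%E.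

Definition target (p : AP) : {set state M} := [set s | `[< label s p >]]%SET.

Definition unreachable (p : AP) : {set state M} :=
  [set s | `[< forall pi : policy, reach_prob pi s p = 0%E >]]%SET.

Definition undecided (p : AP) : {set state M} :=
  (~: (target p :|: unreachable p))%SET.

(* Maximal expected reward in the last k stages. The seed of the maximum is the
   value of an available action, so it does not affect the maximum. *)
Fixpoint reward_to_go (k : nat) (s : state M) : R :=
  if k is k'.+1 then
    let Q a := reward s a + \sum_s' trans s a s' * reward_to_go k' s' in
    \big[Num.max/Q (some_action s)]_(a in avail s) Q a
  else 0.

Definition Vbar (N n : nat) : state M -> R := reward_to_go (N.+1 - n).

Definition Qbar (N n : nat) (s : state M) (a : action M) : R :=
  reward s a + \sum_s' trans s a s' * Vbar N n.+1 s'.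

Lemma Vbar_last N s : Vbar N N.+1 s = 0.
Proof. by rewrite /Vbar subnn. Qed.

Lemma VbarE N n s : (n <= N)%N ->
  Vbar N n s = \big[Num.max/Qbar N n s (some_action s)]_(a in avail s)
    Qbar N n s a.
Proof. by move=> nN; rewrite /Qbar /Vbar subSS subSn. Qed.

Definition optimal_reach (p : AP) : set policy :=
  [set pi | forall pi' : policy,
     (reach_prob pi' (init M) p <= reach_prob pi (init M) p)%E].

End policies.

Arguments target {R AP} M p.
Arguments unreachable {R AP} M p.
Arguments undecided {R AP} M p.
Arguments Vbar {R AP} M N n s.
Arguments Qbar {R AP} M N n s a.
Arguments optimal_reach {R AP} M p.

Section absorbing.
Context {R : realType} {AP : Type} (M : mdp R AP) (X : {set state M}).

Definition absorb_trans (s : state M) (a : action M) (s' : state M) : R :=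
  if s \in X then (s' == s)%:R else trans s a s'.

Lemma absorb_trans_itv s a s' : 0 <= absorb_trans s a s' <= 1.
Proof.
rewrite /absorb_trans; case: ifP => _; last exact: trans_itv.
by case: eqP; rewrite ?ler01 lexx.
Qed.

Lemma absorb_trans_sum s a : a \in avail s -> \sum_s' absorb_trans s a s' = 1.
Proof.
rewrite /absorb_trans; case: (s \in X) => [_|]; last exact: trans_sum.
by rewrite (bigD1 s)//= eqxx big1 ?addr0// => i /negbTE->.
Qed.

Definition absorb : mdp R AP :=
  MDP (init M) (@label _ _ M) (@reward _ _ M) (@avail_neq0 _ _ M)
    absorb_trans_itv absorb_trans_sum.

End absorbing.

Section expansion.
Context {R : realType} {AP : Type} (M : mdp R AP) (N : nat) (N0 : (0 < N)%N).

(* The index i : 'I_N stands for the stage i + 1. *)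
Definition next_stage (i i' : 'I_N) : bool :=
  (i.+1 < N)%N && (i' == i.+1 :> nat) || (i.+1 == N) && (i' == 0%N :> nat).

Definition expand_trans (x : state M * 'I_N) (a : action M)
    (x' : state M * 'I_N) : R :=
  if next_stage x.2 x'.2 then trans x.1 a x'.1 else 0.

Lemma expand_trans_itv x a x' : 0 <= expand_trans x a x' <= 1.
Proof.
by rewrite /expand_trans; case: ifP => _; rewrite ?trans_itv// lexx ler01.
Qed.

Lemma next_stageE i i' : next_stage i i' = (i' == ordS i).
Proof.
rewrite /next_stage -val_eqE /=; have := ltn_ord i; rewrite leq_eqVlt.
case: eqP => [->|_] /=; first by rewrite ltnn modnn.
by move=> iN; rewrite iN modn_small// orbF.
Qed.

Lemma expand_trans_sum (x : (state M * 'I_N)%type) (a : action M) :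
  a \in avail x.1 -> \sum_x' expand_trans x a x' = 1.
Proof.
move=> /trans_sum xa.
rewrite -(pair_bigA _ (fun s' i' => expand_trans x a (s', i'))) /= -[RHS]xa.
apply: eq_bigr => s' _; rewrite -big_mkcond /=.
by rewrite (big_pred1 (ordS x.2))// => i'; rewrite next_stageE.
Qed.

(* The reward is copied along for the record; the costs below are computed
   from that of M. *)
Definition expand : mdp R AP :=
  @MDP R AP (state M * 'I_N)%type (init M, Ordinal N0) (action M)
    (fun x => avail x.1) expand_trans (fun x => label x.1)
    (fun x => reward x.1) (fun x => avail_neq0 x.1)
    expand_trans_itv expand_trans_sum.

Definition all_stages (X : {set state M}) : {set state expand} :=
  [set x : state expand | x.1 \in X]%SET.

Definition expand_absorb (p : AP) : mdp R AP :=
  @absorb _ _ expand (all_stages (target M p) :|: all_stages (unreachable M p))%SET.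

Definition stage_cost (p : AP) (eps : R)
    (x : state (expand_absorb p)) (a : action (expand_absorb p)) : R :=
  if (x \in all_stages (undecided M p)) && (a \in avail x) then
    Vbar M N x.2.+1 x.1 - Qbar M N x.2.+1 x.1 a + eps
  else 0.

Definition Xi (p : AP) : set (policy (expand_absorb p)) :=
  optimal_reach (expand_absorb p) p.

Definition control_cost (p : AP) (eps : R) (pi : policy (expand_absorb p)) : \bar R :=
  total_cost (@stage_cost p eps) pi (init (expand_absorb p)).

End expansion.

Arguments expand_absorb {R AP} M {N} N0 p.
Arguments Xi {R AP} M {N} N0 p.
Arguments control_cost {R AP} M {N} N0 p eps pi.

Definition is_min (R : realType) (A : set (\bar R)) (m : \bar R) : Prop :=
  A m /\ lbound A m.

(* Main.v *)
(* Maximizing the reachability probability and then minimizing the cost is a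
   lexicographic stochastic shortest path problem, since from every undecided
   state some policy reaches the target. Policy improvement solves it for the
   strictly positive running cost [k c + 1] with penalty [k ^ 2] for missing the
   target; for k large its value [k ^ 2 q + k f + t] is compared
   lexicographically in (q, f, t), which yields one stationary policy that
   minimizes the probability q of missing the target, then the cost f, and has
   finite expected duration t. A policy that reaches the target optimally uses
   only actions preserving q and leaves the undecided states almost surely, so
   its cost is at least f: the minimum is attained, even for eps = 0, when the
   cost may vanish along cycles. For the stationary optimum of eps = 0, raising
   eps increases the cost by eps * t, which is finite. *)
Require Import Defs.
From mathcomp Require Import all_boot all_order all_algebra.
From mathcomp Require Import all_classical all_reals all_analysis.
From mathcomp Require Import measurable_realfun ring lra.

Set Implicit Arguments.
Unset Strict Implicit.
Unset Printing Implicit Defensive.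
Import Order.TTheory GRing.Theory Num.Theory.
Import numFieldNormedType.Exports.

Local Open Scope classical_set_scope.
Local Open Scope ring_scope.

(** * Stationary lexicographic optima *)

Section successor_mean.
Context {R : realType} {AP : Type} {M : mdp R AP}.

Definition mean (x : state M) (a : action M) (h : state M -> R) : R :=
  \sum_y trans x a y * h y.

Lemma trans_ge0 (x : state M) a y : 0 <= trans x a y.
Proof. by have /andP[] := trans_itv x a y. Qed.

Lemma meanN x a h : mean x a (fun y => - h y) = - mean x a h.
Proof. by rewrite /mean -sumrN; apply: eq_bigr => y _; rewrite mulrN. Qed.

Lemma meanB x a h g : mean x a (fun y => h y - g y) = mean x a h - mean x a g.
Proof. by rewrite /mean -sumrB; apply: eq_bigr => y _; rewrite mulrBr. Qed.

Lemma mean_le x a h g : (forall y, h y <= g y) -> mean x a h <= mean x a g.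
Proof. by move=> hg; apply: ler_sum => y _; rewrite ler_wpM2l// trans_ge0. Qed.

Lemma mean_cst x a k : a \in avail x -> mean x a (fun=> k) = k.
Proof. by move=> xa; rewrite /mean -mulr_suml trans_sum// mul1r. Qed.

Lemma mean_lt x a h g y : (forall z, h z <= g z) -> 0 < trans x a y ->
  h y < g y -> mean x a h < mean x a g.
Proof.
move=> hg xay hgy; rewrite /mean (bigD1 y)//= [ltRHS](bigD1 y)//=.
rewrite ltr_leD// ?ltr_pM2l//.
by apply: ler_sum => z _; rewrite ler_wpM2l// trans_ge0.
Qed.

End successor_mean.

(** * Proper stationary rules: evaluation, existence and improvement *)

Section stochastic_shortest_path.
Context {R : realType} {AP : Type} {M : mdp R AP} (X : {set state M}).

Implicit Types (mu : {ffun state M -> action M}) (g h : state M -> R).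

(* The witness is a Lyapunov function: its existence makes the expected time
   until X is hit finite. *)
Definition proper mu : Prop := (forall x, mu x \in avail x) /\
  exists h, forall x, x \notin X -> 1 + mean x (mu x) h <= h x.

(** If the maximum of [h] were positive, all successors of a maximizer outside [X] would be
    maximizers too, since [h] lies below its mean there. At a maximizer where the Lyapunov function
    [t] is least, the mean of [t] is then at least [t], contradicting the required drop by 1. *)
Lemma proper_max_principle mu h : proper mu ->
  (forall x, x \in X -> h x <= 0) ->
  (forall x, x \notin X -> h x <= mean x (mu x) h) ->
  forall x, h x <= 0.
Proof.
move=> [muA [t tP]] hX hC x0; rewrite leNgt; apply/negP => h0.
have [m _ mmax] := @arg_maxP _ R _ x0 xpredT h isT.
have hm : 0 < h m by apply: lt_le_trans h0 _; exact: mmax.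
have [s /eqP sE smin] := @arg_minP _ R _ m (fun x => h x == h m) t (eqxx _).
have sX : s \notin X.
  by apply/negP => /hX; rewrite leNgt sE hm.
have hmax y : h y <= h m by exact: mmax.
have succ y : 0 < trans s (mu s) y -> h y = h m.
  move=> sy; apply/eqP; rewrite eq_le hmax /= leNgt; apply/negP => ly.
  have := mean_lt (g := fun=> h m) hmax sy ly.
  by rewrite mean_cst// ltNge -sE hC.
have := tP _ sX; apply/negP; rewrite -ltNge ltr_pwDl//.
rewrite -[leLHS](mean_cst (t s) (muA s)).
apply: ler_sum => y _.
have [->|sy] := eqVneq (trans s (mu s) y) 0; first by rewrite !mul0r.
rewrite ler_wpM2l ?trans_ge0//; apply: smin; apply/eqP/succ.
by rewrite lt_neqAle eq_sym sy trans_ge0.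
Qed.

(** The identity minus the transition matrix of [mu], with the rows of [X] killed, so that the
    linear system prescribes the value on [X] and is the evaluation equation elsewhere. *)
Definition bellman_mx mu : 'M[R]_#|state M| :=
  \matrix_(i, j) ((i == j)%:R - (enum_val i \notin X)%:R *
    trans (enum_val i) (mu (enum_val i)) (enum_val j)).

Definition evaluate mu g (x : state M) : R :=
  (invmx (bellman_mx mu) *m \col_i g (enum_val i)) (enum_rank x) 0.

Lemma bellman_mxE mu (v : 'cV[R]_#|state M|) x :
  (bellman_mx mu *m v) (enum_rank x) 0 = v (enum_rank x) 0 -
    (x \notin X)%:R * mean x (mu x) (fun y => v (enum_rank y) 0).
Proof.
rewrite mxE (eq_bigr (fun j => (j == enum_rank x)%:R * v j 0 -
  (x \notin X)%:R * (trans x (mu x) (enum_val j) * v j 0))); last first.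
  by move=> j _; rewrite mxE enum_rankK mulrBl mulrA eq_sym.
rewrite sumrB; congr (_ - _).
  rewrite (bigD1 (enum_rank x))//= eqxx mul1r big1 ?addr0// => j /negbTE->.
  by rewrite mul0r.
rewrite -mulr_sumr; congr (_ * _).
rewrite (reindex enum_rank) /=; last exact/onW_bij/enum_rank_bij.
by apply: eq_bigr => y _; rewrite enum_rankK.
Qed.

(** A kernel vector vanishes on [X] and equals its own mean elsewhere; the maximum principle for it
    and for its negative makes it zero. *)
Lemma bellman_mx_unit mu : proper mu -> bellman_mx mu \in unitmx.
Proof.
move=> pmu; rewrite -unitmx_tr -row_free_unit; apply: inj_row_free => v v0.
have {}v0 : bellman_mx mu *m v^T = 0.
  by apply: trmx_inj; rewrite trmx_mul trmxK v0 trmx0.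
pose h x := v^T (enum_rank x) 0.
have hE x : h x = (x \notin X)%:R * mean x (mu x) h.
  have := bellman_mxE mu v^T x; rewrite v0 [LHS]mxE => /esym/eqP.
  by rewrite subr_eq0 => /eqP.
have le0 : forall x, h x <= 0.
  apply: (proper_max_principle pmu) => x xX; rewrite hE.
    by rewrite xX mul0r.
  by rewrite xX mul1r.
have ge0 : forall x, - h x <= 0.
  apply: (proper_max_principle pmu) => x xX; rewrite hE.
    by rewrite xX mul0r oppr0.
  by rewrite xX mul1r meanN.
apply/rowP => j; rewrite [RHS]mxE.
have -> : v 0 j = h (enum_val j) by rewrite /h enum_valK mxE.
by apply/eqP; rewrite eq_le le0 -oppr_le0 ge0.
Qed.

Lemma evaluateE mu g : proper mu -> forall x,
  evaluate mu g x = g x + (x \notin X)%:R * mean x (mu x) (evaluate mu g).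
Proof.
move=> pmu x.
have := bellman_mxE mu (invmx (bellman_mx mu) *m \col_i g (enum_val i)) x.
rewrite mulmxA mulmxV ?bellman_mx_unit// mul1mx mxE enum_rankK => ->.
by rewrite -/(evaluate mu g x) subrK.
Qed.

(** Existence of a path into [B] with at most [n] transitions, each of positive probability under an
    available action: the graph form of reaching [B] with positive probability under some policy. *)
Fixpoint hits (B : {set state M}) (n : nat) (x : state M) : bool :=
  (x \in B) || if n is n'.+1 then
    [exists a in avail x, [exists y, (0 < trans x a y) && hits B n' y]]
  else false.

(** Outside [X], the rule picks an action having a possible successor strictly closer to [X]. A
    function of the distance [d] that flattens geometrically is a Lyapunov function, as one
    favourable successor then outweighs all others. *)
Lemma proper_exists (B : {set state M}) : B \subset X ->
  (forall x, x \notin X -> exists n, hits B n x) -> exists mu, proper mu.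
Proof.
move=> BX hitsB.
have hitsX x : exists n, hits X n x.
  case: (boolP (x \in X)) => [xX|/hitsB[n]].
    by exists 0%N; rewrite /= xX.
  move=> xn; exists n; elim: n x xn => [|n IH] x /=.
    by rewrite !orbF => /(fintype.subsetP BX).
  move=> /orP[/(fintype.subsetP BX)->//|/exists_inP[a xa /existsP[y /andP[xy yn]]]].
  apply/orP; right; apply/exists_inP; exists a => //.
  by apply/existsP; exists y; rewrite xy IH.
pose d x := ex_minn (hitsX x).
have dP x : x \notin X -> exists ay : action M * state M,
    [&& ay.1 \in avail x, 0 < trans x ay.1 ay.2 & (d ay.2 < d x)%N].
  move=> xX; rewrite {2}/d; case: ex_minnP => -[|n] /=; rewrite (negbTE xX)//=.
  move=> /exists_inP[a xa /existsP[y /andP[xy yn]]] _; exists (a, y).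
  rewrite /= xa xy /= ltnS /d; case: ex_minnP => m _; exact.
(* The default serves only states of [X]; its action is available, as a proper rule needs at every
   state. *)
pose next x : action M * state M :=
  if pick (fun ay : action M * state M =>
    [&& ay.1 \in avail x, 0 < trans x ay.1 ay.2 & (d ay.2 < d x)%N]) is Some ay
  then ay else (some_action x, x).
have nextP x : x \notin X -> [/\ (next x).1 \in avail x,
    0 < trans x (next x).1 (next x).2 & (d (next x).2 < d x)%N].
  move=> /dP[ay ayP]; rewrite /next; case: pickP => [? /and3P[]//|/(_ ay)].
  by rewrite ayP.
(* All factors lie in [0, 1], so the product is below each of them, and no minimum over a possibly
   empty set is needed. *)
pose th : R := \prod_(x | x \notin X) (trans x (next x).1 (next x).2 / 2).
have th_gt0 : 0 < th.
  by apply: prodr_gt0 => x /nextP[_ ? _]; rewrite divr_gt0.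
have half x : x \notin X -> 0 <= trans x (next x).1 (next x).2 / 2 <= 1.
  move=> _; have /andP[? ?] := trans_itv x (next x).1 (next x).2.
  by apply/andP; split; lra.
have thP x : x \notin X -> th <= trans x (next x).1 (next x).2 / 2.
  move=> xX; rewrite /th (bigD1 x)//= ler_piMr//.
    by case/andP: (half _ xX).
  by apply: prodr_ile1 => y /andP[yX _]; exact: half.
have th_le1 : th <= 1 by apply: prodr_ile1 => x; exact: half.
(* Since [2 * th] is at most the probability of the chosen transition, the mean of [th ^+ d] is at
   least twice its value at [x]. The factor [th ^- D] scales the resulting drop of [t] to at least
   1. *)
pose D := \max_x d x.
pose t x : R := th ^- D * (1 - th ^+ d x).
exists [ffun x => (next x).1]; split.
  move=> x; rewrite ffunE; case: (boolP (x \in X)) => [xX|/nextP[]//].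
  rewrite /next; case: pickP => [? /and3P[]//|_] /=.
  exact: some_action_avail.
exists t => x xX; rewrite ffunE; have [xa xy dlt] := nextP _ xX.
set a := (next x).1 in xa xy *; set y := (next x).2 in xy dlt *.
pose C : R := th ^- D.
have C0 : 0 < C by rewrite invr_gt0 exprn_gt0.
have -> : mean x a t = C - C * mean x a (fun z => th ^+ d z).
  rewrite -[X in X - _](mean_cst C xa) /mean mulr_sumr -sumrB.
  by apply: eq_bigr => z _; rewrite /t -/C; ring.
have le1 : trans x a y * th ^+ (d x).-1 <= mean x a (fun z => th ^+ d z).
  rewrite /mean (bigD1 y)//= ler_wpDr//.
    by apply: sumr_ge0 => z _; rewrite mulr_ge0 ?trans_ge0// exprn_ge0// ltW.
  rewrite ler_pM2l//; apply: ler_wiXn2l => //; first exact: ltW.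
  by rewrite -ltnS (ltn_predK dlt).
have le2 : 2 * th ^+ d x <= trans x a y * th ^+ (d x).-1.
  rewrite -[X in th ^+ X](ltn_predK dlt) exprS mulrA ler_wpM2r//.
    by rewrite exprn_ge0// ltW.
  by have := thP _ xX; rewrite -/a -/y; lra.
have le3 : 1 <= C * th ^+ d x.
  rewrite /C mulrC ler_pdivlMr ?exprn_gt0// mul1r ler_wiXn2l//; first exact: ltW.
  exact: leq_bigmax.
have : C * (2 * th ^+ d x) <= C * mean x a (fun z => th ^+ d z).
  by rewrite ler_pM2l//; exact: le_trans le1.
by rewrite /t -/C; lra.
Qed.


Lemma evaluate_ge0 mu g : proper mu -> (forall x, 0 <= g x) ->
  forall x, 0 <= evaluate mu g x.
Proof.
move=> pmu g0 x; rewrite -oppr_le0; move: x.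
apply: (proper_max_principle pmu) => x xX; rewrite ?meanN evaluateE//.
  by rewrite xX mul0r addr0 oppr_le0.
by rewrite xX mul1r lerN2 ler_wpDl.
Qed.

(** Among the finitely many proper rules, one that minimizes the sum of its values admits no
    improving change of a single action. The conclusion speaks of any solution [W] of the evaluation
    equation, so that [W] may be supplied in closed form. *)
Lemma policy_improvement (g : state M -> action M -> R) b :
  (exists mu, proper mu) -> (forall x a, 1 <= g x a) ->
  exists2 mu, proper mu & forall W, (forall x, x \in X -> W x = b x) ->
    (forall x, x \notin X -> W x = g x (mu x) + mean x (mu x) W) ->
    forall x a, x \notin X -> a \in avail x -> W x <= g x a + mean x a W.
Proof.
move=> [mu0 pmu0] g1.
pose V mu := evaluate mu (fun x => if x \in X then b x else g x (mu x)).
have VX mu x : proper mu -> x \in X -> V mu x = b x.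
  by move=> pmu xX; rewrite /V evaluateE// xX mul0r addr0.
have VC mu x : proper mu -> x \notin X ->
    V mu x = g x (mu x) + mean x (mu x) (V mu).
  by move=> pmu xX; rewrite {1}/V evaluateE// xX mul1r (negbTE xX).
have cmp mu h : proper mu -> (forall x, x \in X -> h x = b x) ->
    (forall x, x \notin X -> g x (mu x) + mean x (mu x) h <= h x) ->
    forall x, V mu x <= h x.
  move=> pmu hX hC x; rewrite -subr_le0; move: x.
  apply: (proper_max_principle pmu) => x xX.
    by rewrite VX// hX// subrr.
  by rewrite meanB VC//; have := hC _ xX; lra.
have [mu /asboolP pmu min] := @arg_minP _ R _ mu0 (fun mu => `[< proper mu >])
  (fun mu => \sum_x V mu x) (asboolT pmu0).
exists mu => // W WX WC x a xX xa.
(* The evaluation equation has a single solution, so [W] is [V mu]. *)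
have VW y : V mu y <= W y by apply: cmp => // z zX; rewrite -WC.
have {VW} WV y : W y = V mu y.
  apply/eqP; rewrite eq_le VW andbT -subr_le0; move: y.
  apply: (proper_max_principle pmu) => y yX.
    by rewrite VX// WX// subrr.
  by rewrite meanB [in leLHS]VC// [in leLHS]WC//; lra.
have -> : mean x a W = mean x a (V mu).
  by rewrite /mean; apply: eq_bigr => y _; rewrite WV.
rewrite WV {WV WX WC W} leNgt; apply/negP => lt.
pose mu' := [ffun y => if y == x then a else mu y].
have mu'x : mu' x = a by rewrite ffunE eqxx.
have le y : y \notin X -> g y (mu' y) + mean y (mu' y) (V mu) <= V mu y.
  move=> yX; rewrite ffunE; case: eqP => [->|_]; first exact: ltW.
  by rewrite -VC.
(* Running costs are at least 1, so [V mu] itself is a Lyapunov function for the modified rule. *)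
have pmu' : proper mu'.
  split; first by move=> y; rewrite ffunE; case: eqP => [->//|_]; case: pmu.
  exists (V mu) => y yX; apply: le_trans (le _ yX).
  by rewrite lerD2r.
have V'V y : V mu' y <= V mu y by apply: cmp => // z zX; rewrite VX.
have := min mu' (asboolT pmu'); apply/negP; rewrite -ltNge.
rewrite (bigD1 x)//= [ltRHS](bigD1 x)//= ltr_leD//; last first.
  by apply: ler_sum => y _.
apply: le_lt_trans lt; rewrite VC// mu'x lerD2l.
exact: mean_le.
Qed.

End stochastic_shortest_path.

(** * Lexicographic comparison of stationary rules through a large penalty *)

(** A negative leading coefficient dominates the other terms once [k] passes an explicit threshold.
    Nonnegativity at a single [k] beyond it suffices, so one [k] can serve finitely many
    polynomials. *)
Lemma quadratic_lead_ge0 (R : realType) (a b d : R) : exists k0 : R,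
  forall k, k0 <= k -> 0 <= k ^+ 2 * a + k * b + d ->
  0 <= a /\ (a = 0 -> 0 <= b).
Proof.
have b0 := normr_ge0 b; have d0 := normr_ge0 d.
have bb := ler_norm b; have dd := ler_norm d.
have [a0|a0|a0] := ltgtP a 0.
- exists (1 + (`|b| + `|d|) / - a) => k; rewrite -lerBrDl ler_pdivrMr; last lra.
  move=> kb.
  have k1 : 1 <= k.
    have : 0 <= (k - 1) * - a by lra.
    by rewrite pmulr_lge0 ?oppr_gt0// subr_ge0.
  by move=> ?; exfalso; nra.
- by exists 0 => k _ _; split; [by []|move=> a00; lra].
- have [b1|b1] := leP 0 b; first by exists 0; rewrite a0.
  exists (1 + `|d| / - b) => k; rewrite -lerBrDl ler_pdivrMr; last lra.
  by move=> kb; rewrite a0 mulr0 add0r => ?; exfalso; nra.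
Qed.

Section lexicographic_optimum.
Context {R : realType} {AP : Type} {M : mdp R AP} (B X : {set state M}).
Variable c : state M -> action M -> R.

(* q is the probability of missing B, f the expected total cost and t the
   expected time until X is hit under the stationary policy mu. *)
Record lex_optimal (mu : {ffun state M -> action M}) (q f t : state M -> R) :
    Prop := LexOptimal {
  lex_avail : forall x, mu x \in avail x;
  lex_q_target : forall x, x \in X -> q x = (x \notin B)%:R;
  lex_q_ge0 : forall x, 0 <= q x;
  lex_q_lt1 : forall x, x \notin X -> q x < 1;
  lex_q_mu : forall x, mean x (mu x) q = q x;
  lex_q_le : forall x a, a \in avail x -> q x <= mean x a q;
  lex_f_ge0 : forall x, 0 <= f x;
  lex_f_X : forall x, x \in X -> f x = 0;
  lex_f_mu : forall x, f x = c x (mu x) + mean x (mu x) f;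
  lex_f_le : forall x a, a \in avail x -> mean x a q = q x ->
    f x <= c x a + mean x a f;
  lex_t_ge0 : forall x, 0 <= t x;
  lex_t_mu : forall x, t x = (x \notin X)%:R + mean x (mu x) t }.

Hypothesis BX : B \subset X.
Hypothesis absX : forall x a y, x \in X -> trans x a y = (y == x)%:R.
Hypothesis hitsB : forall x, x \notin X -> exists n, hits B n x.
Hypothesis c_ge0 : forall x a, 0 <= c x a.
Hypothesis cX : forall x a, x \in X -> c x a = 0.

Let mean_X x a h : x \in X -> mean x a h = h x.
Proof.
move=> xX; rewrite /mean (bigD1 x)//= absX// eqxx mul1r big1 ?addr0// => y.
by rewrite absX// => /negbTE->; rewrite mul0r.
Qed.

(* Optimal policies for the cost [k c + 1] and a penalty [k ^ 2] for missing B
   are compared through the leading coefficients as k grows. *)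
Lemma lex_optimal_exists : exists mu q f t, lex_optimal mu q f t.
Proof.
pose q mu := evaluate X mu (fun x => ((x \in X) && (x \notin B))%:R).
pose f mu := evaluate X mu (fun x => c x (mu x)).
pose t mu := evaluate X mu (fun x => (x \notin X)%:R).
(* The optimal rule depends on [k], so [k] has to exceed the thresholds of all rules, states and
   actions before the rule is chosen. *)
pose I : finType := ({ffun state M -> action M} * state M * action M)%type.
pose k0 (i : I) := sval (cid (quadratic_lead_ge0
  (mean i.1.2 i.2 (q i.1.1) - q i.1.1 i.1.2)
  (c i.1.2 i.2 + mean i.1.2 i.2 (f i.1.1) - f i.1.1 i.1.2)
  (1 + mean i.1.2 i.2 (t i.1.1) - t i.1.1 i.1.2))).
pose k : R := \big[Num.max/0]_i k0 i.
have k_ge0 : 0 <= k by exact: bigmax_ge_id.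
have [mu pmu mu_opt] := policy_improvement
  (g := fun x a => k * c x a + 1)
  (fun x => k ^+ 2 * (x \notin B)%:R) (proper_exists BX hitsB)
  (fun x a => ler_wpDl (mulr_ge0 k_ge0 (c_ge0 x a)) (lexx 1)).
have qE := evaluateE (fun x => ((x \in X) && (x \notin B))%:R) pmu.
have fE := evaluateE (fun x => c x (mu x)) pmu.
have tE := evaluateE (fun x => (x \notin X)%:R) pmu.
have q0 := evaluate_ge0 (g := fun x => ((x \in X) && (x \notin B))%:R) pmu
  (fun x => ler0n _ _).
have f0 := evaluate_ge0 (g := fun x => c x (mu x)) pmu
  (fun x => c_ge0 x (mu x)).
have t0 := evaluate_ge0 (g := fun x => (x \notin X)%:R) pmu
  (fun x => ler0n _ _).
rewrite -/(q mu) in qE q0; rewrite -/(f mu) in fE f0; rewrite -/(t mu) in tE t0.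
have muA : forall x, mu x \in avail x by case: pmu.
(* By linearity this is the value of [mu] for the running cost [k * c + 1] and the penalty
   [k ^+ 2]. *)
pose W x := k ^+ 2 * q mu x + k * f mu x + t mu x.
have meanW x a : mean x a W =
    k ^+ 2 * mean x a (q mu) + k * mean x a (f mu) + mean x a (t mu).
  rewrite /mean !mulr_sumr -!big_split; apply: eq_bigr => y _ /=.
  by rewrite /W; ring.
have lex x a : x \notin X -> a \in avail x -> q mu x <= mean x a (q mu) /\
    (mean x a (q mu) = q mu x -> f mu x <= c x a + mean x a (f mu)).
  move=> xX xa; rewrite -subr_ge0 -[in f mu x <= _]subr_ge0.
  pose i : I := (mu, x, a).
  have kk : k0 i <= k by exact: le_bigmax.
  have := svalP (cid (quadratic_lead_ge0
    (mean i.1.2 i.2 (q i.1.1) - q i.1.1 i.1.2)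
    (c i.1.2 i.2 + mean i.1.2 i.2 (f i.1.1) - f i.1.1 i.1.2)
    (1 + mean i.1.2 i.2 (t i.1.1) - t i.1.1 i.1.2))) _ kk.
  rewrite /= => /(_ _)[|q1 f1].
    have := mu_opt W _ _ x a xX xa; rewrite meanW /W => Wle.
    suff : k ^+ 2 * q mu x + k * f mu x + t mu x <= k * c x a + 1 +
      (k ^+ 2 * mean x a (q mu) + k * mean x a (f mu) + mean x a (t mu)) by lra.
    apply: Wle => y yX.
      rewrite qE fE tE yX cX//= !mul0r !addr0.
      by rewrite mulr0 !addr0.
    rewrite [in LHS]qE [in LHS]fE [in LHS]tE (negbTE yX) /= !mul1r.
    by rewrite add0r -/W meanW; ring.
  by split=> // /eqP; rewrite -subr_eq0 => /eqP.
have qX x : x \in X -> q mu x = (x \notin B)%:R.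
  by move=> xX; rewrite qE xX mul0r addr0.
have q1 : forall x, q mu x <= 1.
  move=> x; rewrite -subr_le0; move: x.
  apply: (proper_max_principle pmu) => x xX.
    by rewrite qX// subr_le0; case: (_ \notin _).
  by rewrite meanB mean_cst// [q mu x]qE xX (negbTE xX) /=; lra.
(* Along a path to [B] the strict inequality passes from a successor back to [x]: some available
   action has mean of [q] below 1, and [q] at [x] does not exceed that mean. *)
have q_lt1 n x : hits B n x -> q mu x < 1.
  elim: n x => [|n IH] x /=.
    by rewrite orbF => xB; rewrite qX ?xB ?(fintype.subsetP BX).
  move=> /orP[xB|]; first by rewrite qX ?xB ?(fintype.subsetP BX).
  move=> /exists_inP[a xa /existsP[y /andP[xy /IH qy]]].
  have [xX|xX] := boolP (x \in X).
    by move: xy qy; rewrite absX//; case: eqP => [->|_]; rewrite ?ltxx.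
  have [/le_lt_trans-> //] := lex x a xX xa.
  by rewrite -[ltRHS](mean_cst 1 xa); exact: mean_lt qy.
exists mu, (q mu), (f mu), (t mu); split=> //.
- by move=> x /hitsB[n]; exact: q_lt1.
- move=> x; have [xX|xX] := boolP (x \in X); first by rewrite mean_X.
  by rewrite [RHS]qE xX (negbTE xX) /= add0r mul1r.
- move=> x a xa; have [xX|xX] := boolP (x \in X); first by rewrite mean_X.
  by have [] := lex x a xX xa.
- by move=> x xX; rewrite fE xX mul0r addr0 cX.
- move=> x; have [xX|xX] := boolP (x \in X); first by rewrite mean_X// cX// add0r.
  by rewrite [LHS]fE xX mul1r.
- move=> x a xa; have [xX|xX] := boolP (x \in X).
    by rewrite !mean_X// cX// add0r lexx.
  by have [] := lex x a xX xa.
- move=> x; have [xX|xX] := boolP (x \in X); first by rewrite mean_X// add0r.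
  by rewrite [LHS]tE xX mul1r.
Qed.

End lexicographic_optimum.

(** * Expectations along runs *)

Lemma big_tuple_cons (R : nmodType) (T : finType) n (F : n.+1.-tuple T -> R) :
  \sum_(h : n.+1.-tuple T) F h =
  \sum_(x : T) \sum_(h : n.-tuple T) F (cons_tuple x h).
Proof.
rewrite pair_big /= (reindex (fun xh => cons_tuple xh.1 xh.2))//.
exists (fun h => (thead h, behead_tuple h)) => [[x h] _|h _] /=.
  by congr (_, _); apply: val_inj.
by rewrite [RHS]tuple_eta; apply: val_inj.
Qed.

Lemma big_pair (R : nmodType) (S T : finType) (F : S * T -> R) :
  \sum_x F x = \sum_s \sum_t F (s, t).
Proof. by rewrite pair_bigA; apply: eq_bigr => -[]. Qed.

Section run_expectation.
Context {R : realType} {AP : Type} {M : mdp R AP}.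
Implicit Types (pi : policy M) (nu : state M -> R) (g : state M -> action M -> R).

Definition push (d : decision_rule M) nu (y : state M) : R :=
  \sum_x \sum_a nu x * rule d x a * trans x a y.

Fixpoint state_law pi nu (t : nat) : state M -> R :=
  if t is t'.+1 then state_law (fun t => pi t.+1) (push (pi 0%N) nu) t' else nu.

(** The expectation of [g] at index [t] as a finite sum; for nonnegative [g], [expect_run]
    identifies it with the integral over runs. *)
Definition expect pi nu t g : R :=
  \sum_x state_law pi nu t x * \sum_a rule (pi t) x a * g x a.

Lemma state_lawS pi nu t :
  state_law pi nu t.+1 = push (pi t) (state_law pi nu t).
Proof. by elim: t pi nu => [//|t IH] pi nu; rewrite -IH. Qed.

Lemma state_law_ge0 pi nu t x : (forall x, 0 <= nu x) -> 0 <= state_law pi nu t x.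
Proof.
elim: t pi nu => [|t IH] pi nu nu0 /=; first exact: nu0.
apply: IH => y; apply: sumr_ge0 => z _; apply: sumr_ge0 => a _.
by rewrite !mulr_ge0 ?rule_ge0 ?trans_ge0.
Qed.

Lemma expectS pi nu t (h : state M -> R) :
  \sum_x state_law pi nu t.+1 x * h x = expect pi nu t (fun x a => mean x a h).
Proof.
rewrite state_lawS /push; under eq_bigr do rewrite mulr_suml.
rewrite exchange_big; apply: eq_bigr => x _ /=.
under eq_bigr do rewrite mulr_suml; rewrite exchange_big mulr_sumr /=.
apply: eq_bigr => a _; rewrite mulrA mulr_sumr.
by apply: eq_bigr => y _; rewrite -!mulrA.
Qed.

(** Only pairs of positive probability contribute, and their actions are available. The weak
    hypothesis admits inequalities that hold just for the actions a given policy really uses. *)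
Lemma expect_le pi nu t g1 g2 : (forall x, 0 <= nu x) ->
  (forall x a, 0 < state_law pi nu t x -> 0 < rule (pi t) x a -> a \in avail x ->
    g1 x a <= g2 x a) ->
  expect pi nu t g1 <= expect pi nu t g2.
Proof.
move=> nu0 g12; apply: ler_sum => x _.
have := state_law_ge0 pi t x nu0; rewrite le_eqVlt => /orP[/eqP<-|lx].
  by rewrite !mul0r.
rewrite ler_pM2l//; apply: ler_sum => a _.
have := rule_ge0 (pi t) x a; rewrite le_eqVlt => /orP[/eqP<-|ra].
  by rewrite !mul0r.
rewrite ler_pM2l// g12//; apply/negPn/negP => /rule_avail ra0.
by rewrite ra0 ltxx in ra.
Qed.

Lemma expect_state pi nu t (h : state M -> R) :
  expect pi nu t (fun x _ => h x) = \sum_x state_law pi nu t x * h x.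
Proof.
by apply: eq_bigr => x _; rewrite -mulr_suml rule_sum mul1r.
Qed.

Lemma expect_lin pi nu t g1 g2 k :
  expect pi nu t (fun x a => g1 x a + k * g2 x a) =
  expect pi nu t g1 + k * expect pi nu t g2.
Proof.
rewrite /expect !mulr_sumr -big_split; apply: eq_bigr => x _ /=.
rewrite mulrCA -mulrDr; congr (_ * _).
rewrite mulr_sumr -big_split; apply: eq_bigr => a _ /=; ring.
Qed.

(** The weight of a nonempty list is linear in the initial law, whereas the empty list has weight 1
    under any law. *)
Lemma run_weight_push pi d nu h x :
  run_weight pi (push d nu) (x :: h) =
  \sum_z \sum_a nu z * rule d z a * run_weight pi (trans z a) (x :: h).
Proof.
case: x => x a /=; rewrite /push !mulr_suml; apply: eq_bigr => z _.
by rewrite !mulr_suml; apply: eq_bigr => b _; rewrite !mulrA.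
Qed.


(** Summing out the first pair replaces the initial law by its image under [push], which is the
    recursion of [state_law]. *)
Lemma sum_run_weight pi nu t (G : (state M * action M)%type -> R) x0 :
  \sum_(h : t.+1.-tuple (state M * action M)%type)
    run_weight pi nu h * G (last x0 h) =
  expect pi nu t (fun x a => G (x, a)).
Proof.
elim: t pi nu x0 => [|t IH] pi nu x0.
  rewrite big_tuple_cons /expect.
  rewrite big_pair.
  apply: eq_bigr => x _; rewrite mulr_sumr; apply: eq_bigr => a _.
  rewrite (big_pred1 [tuple])//=; first by rewrite mulr1 mulrA.
  by move=> h; rewrite (tuple0 h) /= eqxx.
rewrite big_tuple_cons.
transitivity (expect (fun t => pi t.+1) (push (pi 0%N) nu) t
  (fun x a => G (x, a))); last by [].
rewrite -(IH _ _ x0) exchange_big; apply: eq_bigr => h _ /=.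
case/tupleP: h => y h; rewrite [val _]/= run_weight_push mulr_suml.
rewrite big_pair.
apply: eq_bigr => x _; rewrite mulr_suml; apply: eq_bigr => a _ /=.
by case: y => *.
Qed.

Local Notation pair0 := (init M, some_action (init M)).

Lemma measurable_cylinder h : measurable (cylinder pair0 h : set (runs M)).
Proof. by apply: sub_sigma_algebra; exists h. Qed.

(** Exactly one cylinder of length [t.+1] contains the run. Both measurability and the integral
    thereby reduce to cylinders, whose probabilities are known. *)
Lemma run_valueE t (G : (state M * action M)%type -> R) (om : runs M) :
  (G (om t))%:E = (\sum_(h : t.+1.-tuple (state M * action M)%type)
    (G (last pair0 h))%:E * (\1_(cylinder pair0 h : set (runs M)) om)%:E)%E.
Proof.
have sz : size (mkseq om t.+1) == t.+1 by rewrite size_mkseq.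
rewrite (bigD1 (Tuple sz))// big1 => [|h hom].
  rewrite Monoid.mulm1 indicE [tval _]/= mem_set.
    by rewrite mule1 mkseqS last_rcons.
  by rewrite /cylinder /mkset size_mkseq.
rewrite indicE memNset ?mule0// => omh; move/eqP: hom; apply.
by apply: val_inj; rewrite /= -omh /= size_tuple.
Qed.

Let measurable_term (k : R) h : measurable_fun [set: runs M]
  ((fun om => k%:E * (\1_(cylinder pair0 h : set (runs M)) om)%:E)%E :
    runs M -> \bar R).
Proof.
apply: emeasurable_funM => //; apply/measurable_EFinP.
by apply: measurable_indic; exact: measurable_cylinder.
Qed.

Lemma measurable_run_value t (G : (state M * action M)%type -> R) :
  measurable_fun [set: runs M] ((fun om => (G (om t))%:E) : runs M -> \bar R).
Proof.
under eq_fun do rewrite (run_valueE t G).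
by apply: emeasurable_sum => h; exact: measurable_term.
Qed.

Lemma expect_run pi s t g : (forall x a, 0 <= g x a) ->
  (\int[run_law pi s]_om (g (om t).1 (om t).2)%:E =
   (expect pi (start s) t g)%:E)%E.
Proof.
move=> g0; pose G x := g x.1 x.2.
under eq_integral do rewrite (run_valueE t G).
rewrite ge0_integral_sum//; first last.
- by move=> h om _; rewrite mule_ge0// lee_fin ?g0 ?indicE.
rewrite -(sum_run_weight pi (start s) t G pair0) -sumEFin.
apply: eq_bigr => h _; rewrite ge0_integralZl_EFin//; first last.
- exact: g0.
- by apply/measurable_EFinP; apply: measurable_indic; exact: measurable_cylinder.
rewrite integral_indic//; last exact: measurable_cylinder.
by rewrite setIT EFinM muleC; congr (_ * _)%E; exact: run_law_cylinder.
Qed.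

Lemma total_cost_series pi s g : (forall x a, 0 <= g x a) ->
  total_cost g pi s = (\sum_(0 <= t <oo) (expect pi (start s) t g)%:E)%E.
Proof.
move=> g0; rewrite /total_cost integral_nneseries//.
- by apply: eq_eseriesr => t _; rewrite expect_run.
- by move=> t; exact: (measurable_run_value t (fun x => g x.1 x.2)).
- by move=> t om _; rewrite lee_fin g0.
Qed.

Lemma expect_ge0 pi s t g : (forall x a, 0 <= g x a) ->
  0 <= expect pi (start s) t g.
Proof.
move=> g0; apply: sumr_ge0 => x _; apply: mulr_ge0.
  by apply: state_law_ge0 => y; exact: start_ge0.
by apply: sumr_ge0 => a _; rewrite mulr_ge0 ?rule_ge0.
Qed.

Lemma total_cost_ge pi s g n : (forall x a, 0 <= g x a) ->
  ((\sum_(0 <= t < n) expect pi (start s) t g)%:E <= total_cost g pi s)%E.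
Proof.
move=> g0; rewrite total_cost_series// -sumEFin.
by apply: nneseries_lim_ge => t _ _; rewrite lee_fin expect_ge0.
Qed.

Lemma total_cost_le pi s g (b : R) : (forall x a, 0 <= g x a) ->
  (forall n, \sum_(0 <= t < n) expect pi (start s) t g <= b) ->
  (total_cost g pi s <= b%:E)%E.
Proof.
move=> g0 gb; rewrite total_cost_series//; apply: lime_le.
  by apply: is_cvg_nneseries => t _ _; rewrite lee_fin expect_ge0.
by near=> n; rewrite sumEFin lee_fin.
Unshelve. all: by end_near.
Qed.

(** There are countably many finite lists, and those of weight zero have null cylinders. Outside
    this null set runs can be analysed path by path. *)
Lemma run_positive pi s : (run_law pi s).-negligible
  [set om | exists n, run_weight pi (start s) (mkseq om n) = 0].
Proof.
pose Z h : set (runs M) :=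
  if run_weight pi (start s) h == 0 then cylinder pair0 h else set0.
exists (\bigcup_h Z h); split.
- apply: countable_bigcupT_measurable; first exact: countableP.
  by move=> h; rewrite /Z; case: ifP => // _; exact: measurable_cylinder.
- apply: measure_negligible.
    apply: countable_bigcupT_measurable; first exact: countableP.
    by move=> h; rewrite /Z; case: ifP => // _; exact: measurable_cylinder.
  have negl_Z o : (run_law pi s).-negligible (oapp Z set0 o).
    case: o => [h|] /=; last exact: negligible_set0.
    rewrite /Z; case: eqP => [h0|_]; last exact: negligible_set0.
    apply/negligibleP; first exact: measurable_cylinder.
    by apply: etrans (run_law_cylinder _ _ _) _; rewrite h0.
  apply: negligibleS (negligible_bigcup (fun n => negl_Z (unpickle n))).
  by move=> om [h _ Zh]; exists (pickle h) => //; rewrite pickleK.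
- move=> om [n n0]; exists (mkseq om n) => //.
  by rewrite /Z n0 eqxx /cylinder /mkset size_mkseq.
Qed.

End run_expectation.

(** * Reachability *)

Section reachability.
Context {R : realType} {AP : Type} {M : mdp R AP} (p : AP).
Implicit Types (pi : policy M) (nu : state M -> R).

Local Notation pair0 := (init M, some_action (init M)).

Lemma run_weight_step pi nu h x0 i : (i.+1 < size h)%N ->
  run_weight pi nu h != 0 ->
  (nth x0 h i).2 \in avail (nth x0 h i).1 /\
  0 < trans (nth x0 h i).1 (nth x0 h i).2 (nth x0 h i.+1).1.
Proof.
elim: h i pi nu => [//|[x a] h IH] i pi nu /= ih.
rewrite !mulf_eq0 !negb_or => /andP[/andP[_ ra] hn].
case: i ih => [|i] ih; last exact: (IH _ _ _ ih hn).
split; first by apply/negPn/negP => /rule_avail r0; rewrite r0 eqxx in ra.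
case: h hn {IH} ih => [//|[y b] h] /=; rewrite !mulf_eq0 !negb_or.
by move=> /andP[/andP[xy _] _] _; rewrite lt_neqAle eq_sym xy trans_ge0.
Qed.

Lemma run_step (om : runs M) pi s :
  ~ (exists n, run_weight pi (start s) (mkseq om n) = 0) ->
  (om 0%N).1 = s /\ forall t, (om t).2 \in avail (om t).1 /\
    0 < trans (om t).1 (om t).2 (om t.+1).1.
Proof.
move=> pos; split=> [|t].
  apply/eqP; apply: contra_notT pos => ne; exists 1%N.
  rewrite /mkseq /=; case: (om 0%N) ne => x a /= /negbTE.
  by rewrite /start => ->; rewrite !mul0r.
have /eqP w0 : run_weight pi (start s) (mkseq om t.+2) <> 0.
  by move=> w0; apply: pos; exists t.+2.
have := @run_weight_step _ _ _ pair0 t _ w0.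
by rewrite size_mkseq !nth_mkseq// => /(_ (ltnSn _)).
Qed.

Definition at_target t : set (runs M) := [set om | (om t).1 \in target M p].

Lemma indic_at_target t om :
  \1_(at_target t) om = ((om t).1 \in target M p)%:R :> R.
Proof. by rewrite indicE; congr (_%:R); rewrite mem_setE. Qed.

Lemma measurable_at_target t : measurable (at_target t).
Proof.
have := measurable_run_value t
  (fun x : state M * action M => (x.1 \in target M p)%:R : R).
move=> /(_ measurableT [set 1%E] (emeasurable_set1 _)); rewrite setTI.
congr measurable; apply/seteqP; split=> om; rewrite /at_target /=.
  by case: (_ \in _) => // -[/eqP]; rewrite eq_sym oner_eq0.
by move=> ->.
Qed.

Lemma reach_bigcup :
  [set om : runs M | exists t, label (om t).1 p] = \bigcup_t at_target t.
Proof.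
apply/seteqP; split=> om /=.
  by move=> [t omt]; exists t => //; rewrite /at_target /= inE; exact/asboolP.
by move=> [t _]; rewrite /at_target /= inE => /asboolP omt; exists t.
Qed.

Lemma measurable_reach :
  measurable [set om : runs M | exists t, label (om t).1 p].
Proof.
rewrite reach_bigcup; apply: bigcupT_measurable => t.
exact: measurable_at_target.
Qed.

Lemma prob_at_target pi s t : run_law pi s (at_target t) =
  (\sum_(x in target M p) state_law pi (start s) t x)%:E.
Proof.
have := expect_run pi s t (g := fun x _ => (x \in target M p)%:R)
  (fun x _ => ler0n _ _).
rewrite expect_state.
under eq_integral do rewrite -indic_at_target.
rewrite integral_indic ?setIT//; last exact: measurable_at_target.
move=> ->; congr (_%:E); rewrite [RHS]big_mkcond; apply: eq_bigr => x _.
by case: ifP => _; rewrite ?mulr1 ?mulr0.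
Qed.

Lemma reach_prob_ge pi s t :
  ((\sum_(x in target M p) state_law pi (start s) t x)%:E
    <= reach_prob pi s p)%E.
Proof.
rewrite -prob_at_target /reach_prob reach_bigcup; apply: le_measure.
- by rewrite inE; exact: measurable_at_target.
- by rewrite inE -reach_bigcup; exact: measurable_reach.
- exact: bigcup_sup.
Qed.

(** Almost every run that has entered the target stays there, so having visited it by index [n] is
    almost surely being in it at index [n]. Reachability is the increasing limit of these events,
    hence a bound from [n0] on is enough. *)
Lemma reach_prob_le pi s n0 (b : R) :
  (forall x a y, x \in target M p -> 0 < trans x a y -> y \in target M p) ->
  (forall n, (n0 <= n)%N ->
    \sum_(x in target M p) state_law pi (start s) n x <= b) ->
  (reach_prob pi s p <= b%:E)%E.
Proof.
move=> absB le_b; rewrite /reach_prob reach_bigcup.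
pose E n := \bigcup_(t in [set t | (t <= n)%N]) at_target t.
have mE n : measurable (E n).
  by apply: bigcup_measurable => t _; exact: measurable_at_target.
have bigE : \bigcup_t at_target t = \bigcup_n E n.
  apply/seteqP; split=> om [t _ omt]; first by exists t => //; exists t => /=.
  by case: omt => u _ omu; exists u.
have cvgE : run_law pi s \o E @ \oo --> run_law pi s (\bigcup_n E n).
  apply: nondecreasing_cvg_mu => //.
    by rewrite -bigE -reach_bigcup; exact: measurable_reach.
  move=> m n mn; apply/subsetPset; apply: bigcup_subset => t /= tm.
  exact: leq_trans mn.
rewrite bigE -(cvg_lim _ cvgE)//; apply: lime_le.
  by apply/cvg_ex; eexists; exact: cvgE.
near=> n; rewrite /=.
apply: (@le_trans _ _ (run_law pi s (at_target n))); last first.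
  by rewrite prob_at_target lee_fin le_b//; near: n; exact: nbhs_infty_ge.
have [Z [mZ Z0 subZ]] := run_positive pi s.
rewrite -(measureU0 (measurable_at_target n) mZ Z0); apply: le_measure.
- by rewrite inE.
- by rewrite inE; apply: measurableU => //; exact: measurable_at_target.
move=> om [t /= tn omt].
have [/subZ|] := pselect (exists n, run_weight pi (start s) (mkseq om n) = 0).
  by right.
move=> /run_step[_ step]; left.
rewrite -(subnKC tn); elim: (n - t)%N => [|k IH]; first by rewrite addn0.
by rewrite addnS; have [_ /absB] := step (t + k)%N; exact.
Unshelve. all: by end_near.
Qed.

(** An event that is not null contains a run all of whose prefixes have positive weight; its initial
    part is the path. *)
Lemma reach_prob_hits pi s : reach_prob pi s p <> 0%E ->
  exists n, hits (target M p) n s.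
Proof.
move=> reach; have [om [omZ [t omt]]] : exists om : runs M,
    ~ (exists n, run_weight pi (start s) (mkseq om n) = 0) /\
    exists t, label (om t).1 p.
  apply: contra_notP reach => none.
  apply: measure_negligible; first exact: measurable_reach.
  apply: negligibleS (run_positive pi s) => om omr /=.
  by apply: contrapT => pos; apply: none; exists om.
have [<- step] := run_step omZ; exists t.
suff : forall k u, (u + k = t)%N -> hits (target M p) k (om u).1.
  by move=> /(_ t 0%N) ->.
elim=> [|k IH] u ut.
  by rewrite /= orbF inE; move: ut; rewrite addn0 => ->; exact/asboolP.
have [av tr] := step u; rewrite /=; apply/orP; right.
apply/exists_inP; exists (om u).2 => //; apply/existsP; exists (om u.+1).1.
by rewrite tr IH// addSnnS.
Qed.

(** * The uniform policy, which follows every possible path with positive probability *)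

Lemma uniform_rule_sum (s : state M) :
  \sum_a (a \in avail s)%:R / #|avail s|%:R = 1 :> R.
Proof.
rewrite -mulr_suml.
have -> : \sum_a (a \in avail s)%:R = #|avail s|%:R :> R.
  rewrite -sum1_card natr_sum [RHS]big_mkcond.
  by apply: eq_bigr => a _; case: (a \in _).
by rewrite divff// pnatr_eq0 cards_eq0 avail_neq0.
Qed.

Lemma uniform_rule_ge0 (s : state M) a :
  0 <= (a \in avail s)%:R / #|avail s|%:R :> R.
Proof. by rewrite divr_ge0. Qed.

Lemma uniform_rule_avail (s : state M) a : a \notin avail s ->
  (a \in avail s)%:R / #|avail s|%:R = 0 :> R.
Proof. by move=> /negbTE->; rewrite mul0r. Qed.

Definition uniform_rule : decision_rule M :=
  DecisionRule uniform_rule_ge0 uniform_rule_sum uniform_rule_avail.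

Lemma uniform_rule_gt0 s a : a \in avail s -> 0 < rule uniform_rule s a.
Proof.
move=> sa; rewrite /= sa divr_gt0// ltr0n card_gt0.
exact: avail_neq0.
Qed.

Lemma hits_run_weight n s nu : hits (target M p) n s -> 0 < nu s ->
  exists x h, 0 < run_weight (fun=> uniform_rule) nu (x :: h) /\
    label (last x h).1 p.
Proof.
have base s' nu' : s' \in target M p -> 0 < nu' s' ->
    exists x h, 0 < run_weight (fun=> uniform_rule) nu' (x :: h) /\
    label (last x h).1 p.
  move=> sB nus; exists (s', some_action s'), [::]; split; last first.
    by move: sB; rewrite inE => /asboolP.
  rewrite [run_weight _ _ _]/= mulr1 mulr_gt0// uniform_rule_gt0//.
  exact: some_action_avail.
elim: n s nu => [|n IH] s nu /=; first by rewrite orbF; exact: base.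
move=> /orP[|/exists_inP[a sa /existsP[y /andP[sy ny]]] nus]; first exact: base.
have [x [h [hw hl]]] := IH y (trans s a) ny sy.
exists (s, a), (x :: h); split=> //.
change (0 < nu s * rule uniform_rule s a *
  run_weight (fun=> uniform_rule) (trans s a) (x :: h)).
by rewrite mulr_gt0// mulr_gt0// uniform_rule_gt0.
Qed.

(** The path spans a cylinder of positive probability under the uniform policy, and every run in it
    reaches the target. *)
Lemma hits_reach_prob n s : hits (target M p) n s ->
  exists pi, reach_prob pi s p <> 0%E.
Proof.
move=> hs; exists (fun=> uniform_rule) => reach0.
have s1 : 0 < start s s :> R by rewrite /start eqxx.
have [x [h [hw hl]]] := hits_run_weight hs s1.
suff : (run_law (fun=> uniform_rule) s (cylinder pair0 (x :: h)) <= 0)%E.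
  by rewrite [leLHS]run_law_cylinder lee_fin leNgt hw.
rewrite -reach0; apply: le_measure.
- by rewrite inE; exact: measurable_cylinder.
- by rewrite inE; exact: measurable_reach.
move=> om omh; exists (size h).
by move: hl; rewrite (last_nth pair0) -omh nth_mkseq.
Qed.

Lemma undecided_hits s : s \in undecided M p -> exists n, hits (target M p) n s.
Proof.
rewrite !inE negb_or => /andP[_ /asboolP un].
have [pi reach] : exists pi, reach_prob pi s p <> 0%E by exact/existsNP.
exact: reach_prob_hits reach.
Qed.

Lemma hits_reachable n s : hits (target M p) n s -> s \notin unreachable M p.
Proof.
move=> /hits_reach_prob[pi reach]; rewrite inE; apply/asboolP => un.
by apply: reach; exact: un.
Qed.

End reachability.

(** * Optimality among all policies *)

Section verification.
Context {R : realType} {AP : Type} {M : mdp R AP} (p : AP) (X : {set state M}).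
Variables (c : state M -> action M -> R) (mu : {ffun state M -> action M}).
Variables (q f t : state M -> R).

Local Notation x0 := (init M).
Local Notation B := (target M p).
Local Notation law pi := (state_law pi (start x0)).

Hypothesis BX : B \subset X.
Hypothesis absX : forall x a y, x \in X -> trans x a y = (y == x)%:R.
Hypothesis c_ge0 : forall x a, 0 <= c x a.
Hypothesis opt : lex_optimal B X c mu q f t.

Let law_ge0 pi n x : 0 <= law pi n x.
Proof. by apply: state_law_ge0 => y; exact: start_ge0. Qed.

Let law0 (h : state M -> R) pi : \sum_x law pi 0%N x * h x = h x0.
Proof.
rewrite (bigD1 x0)//= /start eqxx mul1r big1 ?addr0// => x /negbTE->.
by rewrite mul0r.
Qed.

Let law_le pi n (h1 h2 : state M -> R) : (forall x, h1 x <= h2 x) ->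
  \sum_x law pi n x * h1 x <= \sum_x law pi n x * h2 x.
Proof. by move=> h12; apply: ler_sum => x _; rewrite ler_wpM2l. Qed.

Let le_start x : 0 <= start x0 x :> R. Proof. exact: start_ge0. Qed.

Let law_sum pi n : \sum_x law pi n x = 1.
Proof.
suff : \sum_x law pi n x * 1 = 1 by under eq_bigr do rewrite mulr1.
elim: n => [|n IH]; first by rewrite (law0 (fun=> 1)).
rewrite (expectS pi (start x0) n (fun=> 1)) -[RHS]IH -expect_state.
apply/eqP; rewrite eq_le; apply/andP.
by split; apply: expect_le => // x a _ _ xa; rewrite mean_cst.
Qed.

(** * The stationary policy of a lexicographic optimum and its reachability *)

Lemma det_rule_sum x : \sum_a (a == mu x)%:R = 1 :> R.
Proof. by rewrite (bigD1 (mu x))//= eqxx big1 ?addr0// => a /negbTE->. Qed.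

Lemma det_rule_avail x a : a \notin avail x -> (a == mu x)%:R = 0 :> R.
Proof.
by case: eqP => [->|//]; rewrite (lex_avail opt).
Qed.

Definition stationary : policy M :=
  fun=> DecisionRule (fun x a => ler0n R (a == mu x)) det_rule_sum det_rule_avail.

Let stationary_expect n g :
  expect stationary (start x0) n g = \sum_x law stationary n x * g x (mu x).
Proof.
apply: eq_bigr => x _; congr (_ * _).
rewrite (bigD1 (mu x))//= eqxx mul1r big1 ?addr0// => a /negbTE->.
by rewrite mul0r.
Qed.

(** The evaluation equation telescopes along the run, leaving the expectation of [h] at index [n] as
    remainder. *)
Lemma stationary_cost (g : state M -> action M -> R) (h : state M -> R) n :
  (forall x, h x = g x (mu x) + mean x (mu x) h) ->
  \sum_(0 <= i < n) expect stationary (start x0) i g +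
    \sum_x law stationary n x * h x = h x0.
Proof.
move=> hE; elim: n => [|n IH]; first by rewrite big_nil add0r law0.
rewrite big_nat_recr//= -[RHS]IH -addrA; congr (_ + _).
rewrite -[X in _ + X]/(\sum_x law stationary n.+1 x * h x).
rewrite expectS !stationary_expect -big_split; apply: eq_bigr => x _ /=.
by rewrite -mulrDr -hE.
Qed.

Lemma stationary_total_cost (g : state M -> action M -> R) (h : state M -> R) :
  (forall x a, 0 <= g x a) -> (forall x, 0 <= h x) ->
  (forall x, h x = g x (mu x) + mean x (mu x) h) ->
  (total_cost g stationary x0 <= (h x0)%:E)%E.
Proof.
move=> g0 h0 hE; apply: total_cost_le => // n.
rewrite -(stationary_cost n hE) lerDl.
by apply: sumr_ge0 => x _; rewrite mulr_ge0.
Qed.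

Let q_incr pi n :
  \sum_x law pi n x * q x <= \sum_x law pi n.+1 x * q x.
Proof.
rewrite expectS -expect_state; apply: expect_le => // x a _ _ xa.
exact: lex_q_le opt x a xa.
Qed.

Let q_mono pi m n : (m <= n)%N ->
  \sum_x law pi m x * q x <= \sum_x law pi n x * q x.
Proof.
move=> /subnKC<-; elim: (n - m)%N => [|k IH]; first by rewrite addn0.
by rewrite addnS; apply: le_trans IH (q_incr _ _).
Qed.

(** On [X], [1 - q] is the indicator of [B]; off [X] the terms cancel. The last sum is the weighted
    mass still undecided. *)
Let target_law pi n : \sum_(x in B) law pi n x =
  1 - \sum_x law pi n x * q x
    - \sum_x law pi n x * ((x \notin X)%:R * (1 - q x)).
Proof.
rewrite -[X in X - _ - _](law_sum pi n) -!sumrB big_mkcond; apply: eq_bigr => x _.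
have [xX|xX] := boolP (x \in X).
  rewrite (lex_q_target opt xX); case: (x \in B) => /=; ring.
have /negbTE-> : x \notin B by apply: contra xX; exact: (fintype.subsetP BX).
by rewrite /=; ring.
Qed.

Let undecided_ge0 x : 0 <= (x \notin X)%:R * (1 - q x).
Proof.
have [xX|xX] := boolP (x \in X); first by rewrite mul0r.
by rewrite mul1r subr_ge0 ltW// (lex_q_lt1 opt xX).
Qed.

Let absB x a y : x \in B -> 0 < trans x a y -> y \in B.
Proof.
move=> xB; rewrite absX ?(fintype.subsetP BX)//.
by case: eqP => [->|]; rewrite ?ltxx.
Qed.

(** Under any policy [q] is a submartingale, so its mean at later indices only lowers the
    probability of being in the target. *)
Lemma reach_prob_le_q pi n :
  (reach_prob pi x0 p <= (1 - \sum_x law pi n x * q x)%:E)%E.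
Proof.
apply: (reach_prob_le (n0 := n) absB) => m nm.
rewrite target_law lerBlDr ler_wpDr//; last by rewrite lerD2l lerN2 q_mono.
by apply: sumr_ge0 => x _; rewrite mulr_ge0.
Qed.

(** Under [mu] the mean of [q] is constant, and the undecided mass becomes arbitrarily small because
    the expected duration [t] is finite. *)
Lemma stationary_reach : (1 - q x0)%:E%E = reach_prob stationary x0 p.
Proof.
apply/eqP; rewrite eq_le; apply/andP; split; last first.
  by have := reach_prob_le_q stationary 0%N; rewrite law0.
apply/lee_addgt0Pr => e e0.
have [n small] : exists n, \sum_x law stationary n x * (x \notin X)%:R < e.
  apply: contrapT => /forallNP large.
  (* Undecided mass of at least [e] at every index would make the expected duration exceed every
     bound. *)
  have tle n : n%:R * e <= t x0.
    rewrite -(stationary_cost (g := fun x _ => (x \notin X)%:R) n (lex_t_mu opt)).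
    rewrite ler_wpDr//.
      by apply: sumr_ge0 => x _; rewrite mulr_ge0// (lex_t_ge0 opt).
    rewrite mulr_natl -[X in _ *+ X]subn0 -sumr_const_nat.
    by apply: ler_sum => i _; rewrite expect_state leNgt; apply/negP/large.
  have := tle (Num.bound (t x0 / e)); apply/negP; rewrite -ltNge.
  rewrite -ltr_pdivrMr//; apply: archi_boundP.
  by rewrite divr_ge0 ?(lex_t_ge0 opt)// ltW.
have := reach_prob_ge p stationary x0 n; rewrite target_law.
have -> : \sum_x law stationary n x * q x = q x0.
  have := stationary_cost (g := fun _ _ => 0) (h := q) n.
  rewrite big1_seq ?add0r => [->//|i _].
    by move=> x; rewrite add0r (lex_q_mu opt).
  by rewrite /expect big1// => x _; rewrite big1 ?mulr0// => a _; rewrite mulr0.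
move=> le_reach; apply: (@le_trans _ _ (1 - q x0 -
    \sum_x law stationary n x * ((x \notin X)%:R * (1 - q x)) + e)%:E).
  rewrite lee_fin -addrA lerDl addrC subr_ge0; apply: le_trans (ltW small).
  apply: law_le => x; rewrite ler_piMr// gerBl; exact: lex_q_ge0 opt x.
by rewrite EFinD leeD2r.
Qed.

Lemma stationary_optimal : optimal_reach M p stationary.
Proof.
move=> pi; rewrite -stationary_reach.
by have := reach_prob_le_q pi 0%N; rewrite law0.
Qed.

(** * Lower bound on the cost of policies that reach the target optimally *)

Lemma expect_eq0 pi n g :
  (forall x a, a \in avail x -> 0 <= g x a) ->
  expect pi (start x0) n g = 0 ->
  forall x a, 0 < law pi n x -> 0 < rule (pi n) x a -> g x a = 0.
Proof.
move=> g0 e0 x a lx ra.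
have term_ge0 y b : 0 <= rule (pi n) y b * g y b.
  have [yb|yb] := boolP (b \in avail y); last by rewrite rule_avail// mul0r.
  by rewrite mulr_ge0 ?rule_ge0 ?g0.
have /psumr_eq0P/(_ x isT)/eqP : expect pi (start x0) n g = 0 by [].
rewrite mulf_eq0 gt_eqF//= => sum0.
have /psumr_eq0P/(_ a isT)/eqP : \sum_b rule (pi n) x b * g x b = 0.
  by apply/eqP; apply: sum0 => y _; rewrite mulr_ge0 ?sumr_ge0.
by rewrite mulf_eq0 gt_eqF//= => /(_ (fun b _ => term_ge0 x b))/eqP.
Qed.

Section optimal_policies.
Variable pi : policy M.
Hypothesis pi_opt : optimal_reach M p pi.

Let reach_pi : ((1 - q x0)%:E <= reach_prob pi x0 p)%E.
Proof. by rewrite stationary_reach; exact: pi_opt. Qed.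

(** The mean of [q] cannot decrease, and any increase would push the reachability probability below
    its optimum. *)
Lemma optimal_q n : \sum_x law pi n x * q x = q x0.
Proof.
apply/eqP; rewrite eq_le; apply/andP; split; last first.
  by have := q_mono pi (leq0n n); rewrite law0.
by have := le_trans reach_pi (reach_prob_le_q pi n); rewrite lee_fin lerD2l lerN2.
Qed.

Lemma optimal_cost_ge n : f x0 <=
  \sum_(0 <= i < n) expect pi (start x0) i c + \sum_x law pi n x * f x.
Proof.
elim: n => [|n IH]; first by rewrite big_nil add0r law0.
apply: le_trans IH _; rewrite big_nat_recr//= -addrA lerD2l.
rewrite -[X in _ + X]/(\sum_x law pi n.+1 x * f x) expectS -expect_state.
have := expect_lin pi (start x0) n c (fun x a => mean x a f) 1.
rewrite mul1r => <-; apply: expect_le => // x a lx ra xa; rewrite mul1r.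
(* As the mean of [q] is constant, the nonnegative difference [mean x a q - q x] has expectation
   zero and vanishes at every pair that occurs; this is the condition for the inequality on [f]. *)
apply: (lex_f_le opt) => //; apply/eqP; rewrite -subr_eq0; apply/eqP; move: lx ra.
apply: (@expect_eq0 pi n (fun x a => mean x a q - q x)).
  by move=> y b yb; rewrite subr_ge0 (lex_q_le opt).
have := expect_lin pi (start x0) n (fun x a => mean x a q) (fun x _ => q x) (-1).
rewrite -expectS expect_state !optimal_q mulN1r subrr => <-.
by apply: eq_bigr => y _; congr (_ * _); apply: eq_bigr => b _; rewrite mulN1r.
Qed.

(** The remainder in [optimal_cost_ge] has to become small. It is at most [C] times the weighted
    undecided mass, because [f] vanishes on [X] and [q < 1] off [X]. *)
Lemma optimal_total_cost_ge : ((f x0)%:E <= total_cost c pi x0)%E.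
Proof.
pose C := \sum_(x | x \notin X) f x / (1 - q x).
have C0 : 0 <= C.
  apply: sumr_ge0 => x xX; rewrite divr_ge0 ?(lex_f_ge0 opt)//.
  by rewrite subr_ge0 ltW// (lex_q_lt1 opt).
have fC x : f x <= C * ((x \notin X)%:R * (1 - q x)).
  have [xX|xX] := boolP (x \in X); first by rewrite (lex_f_X opt xX) mul0r mulr0.
  have qx : 0 < 1 - q x by rewrite subr_gt0 (lex_q_lt1 opt).
  rewrite mul1r -ler_pdivrMr// /C (bigD1 x)//= lerDl.
  apply: sumr_ge0 => y /andP[yX _]; rewrite divr_ge0 ?(lex_f_ge0 opt)//.
  by rewrite subr_ge0 ltW// (lex_q_lt1 opt).
apply/lee_addgt0Pr => e e0.
pose d := e / (C + 1).
have d0 : 0 < d by rewrite divr_gt0// ltr_wpDl.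
(* If this mass stayed at least [d], the probability of being in the target would stay [d] below the
   optimal reachability. *)
have [n small] : exists n,
    \sum_x law pi n x * ((x \notin X)%:R * (1 - q x)) < d.
  apply: contrapT => /forallNP large.
  have : (reach_prob pi x0 p <= (1 - q x0 - d)%:E)%E.
    apply: (reach_prob_le (n0 := 0%N) absB) => m _.
    rewrite target_law optimal_q lerD2l lerN2 leNgt; apply/negP/large.
  by move=> /(le_trans reach_pi); rewrite lee_fin lerDl oppr_ge0 leNgt d0.
apply: (@le_trans _ _ (\sum_(0 <= i < n) expect pi (start x0) i c + e)%:E).
  rewrite lee_fin; apply: le_trans (optimal_cost_ge n) _; rewrite lerD2l.
  apply: le_trans (law_le pi n fC) _.
  under eq_bigr do rewrite mulrCA; rewrite -mulr_sumr.
  apply: (@le_trans _ _ (C * d)); first by rewrite ler_wpM2l// ltW.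
  by rewrite /d mulrCA ler_piMr ?ltW// ltr_pdivrMr ?ltr_wpDl// mul1r ltrDl.
by rewrite EFinD leeD2r// total_cost_ge.
Qed.

End optimal_policies.

Lemma stationary_is_min :
  is_min [set total_cost c pi x0 | pi in optimal_reach M p] (f x0)%:E.
Proof.
split; last by move=> _ [pi pi_opt <-]; exact: optimal_total_cost_ge.
exists stationary; first exact: stationary_optimal.
apply/eqP; rewrite eq_le optimal_total_cost_ge ?andbT; last first.
  exact: stationary_optimal.
exact: stationary_total_cost (lex_f_ge0 opt) (lex_f_mu opt).
Qed.

End verification.

(** * The expanded decision process *)

Section expanded_mdp.
Context {R : realType} {AP : Type} (M : mdp R AP) (N : nat) (N0 : (0 < N)%N).
Variable p : AP.

Local Notation M' := (expand_absorb M N0 p).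

Definition decided : {set state M'} :=
  (all_stages N0 (target M p) :|: all_stages N0 (unreachable M p))%SET.

Lemma in_all_stages (Y : {set state M}) (x : state M') :
  (x \in all_stages N0 Y) = (x.1 \in Y).
Proof. by rewrite finset.in_set. Qed.

Lemma in_decided (x : state M') :
  (x \in decided) = (x.1 \notin undecided M p).
Proof. by rewrite !inE negbK. Qed.

Lemma in_target_expand (x : state M') :
  (x \in target M' p) = (x.1 \in target M p).
Proof. by rewrite !inE. Qed.

Lemma target_decided : target M' p \subset decided.
Proof.
apply/fintype.subsetP => x; rewrite in_target_expand => xB.
by rewrite in_decided !inE negbK; move: xB; rewrite inE => ->.
Qed.

Lemma decided_absorbing (x : state M') (a : action M') y : x \in decided ->
  trans x a y = (y == x)%:R.
Proof. by move=> xX; rewrite /= /absorb_trans ifT. Qed.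

(** A state outside the target that starts such a path is undecided, so it has not been made
    absorbing; each transition of the path lifts by advancing the stage cyclically. *)
Lemma hits_expand n (s : state M) (i : 'I_N) : hits (target M p) n s ->
  hits (target M' p) n ((s, i) : state M').
Proof.
elim: n s i => [|n IH] s i hs.
  by move: hs; rewrite /= !orbF in_target_expand.
have [sB|sB] := boolP (s \in target M p); first by rewrite /= in_target_expand sB.
have sX : ((s, i) : state M') \notin decided.
  by rewrite in_decided negbK finset.in_setC finset.in_setU negb_or sB
    (hits_reachable hs).
move: hs; rewrite /= (negbTE sB) => /exists_inP[a sa /existsP[y /andP[sy ny]]].
apply/orP; right; apply/exists_inP; exists a => //.
apply/existsP; exists (y, ordS i); rewrite IH// andbT.
rewrite /absorb_trans ifN// /= /expand_trans /= next_stageE eqxx.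
exact: sy.
Qed.

Lemma undecided_hits_expand (x : state M') : x \notin decided ->
  exists n, hits (target M' p) n x.
Proof.
case: x => s i; rewrite in_decided negbK => s_undec.
have [n hn] := undecided_hits s_undec.
by exists n; exact: hits_expand.
Qed.

Lemma stage_cost_ge0 eps (x : state M') (a : action M') : 0 <= eps ->
  0 <= stage_cost eps x a.
Proof.
move=> e0; rewrite /stage_cost; case: ifP => // /andP[_ xa].
rewrite addr_ge0// subr_ge0 VbarE//.
exact: (le_bigmax_cond _ (fun a => Qbar M N x.2.+1 x.1 a)).
Qed.

Lemma stage_cost_decided eps (x : state M') (a : action M') : x \in decided ->
  stage_cost eps x a = 0.
Proof. by rewrite in_decided /stage_cost in_all_stages => /negbTE->. Qed.

(** The parameter [eps] is a charge per undecided stage, so in total it multiplies the expected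
    duration. *)
Lemma stage_costD eps (x : state M') (a : action M') : a \in avail x ->
  stage_cost eps x a = stage_cost 0 x a + eps * (x \notin decided)%:R.
Proof.
move=> xa; rewrite in_decided negbK /stage_cost in_all_stages xa andbT.
by case: ifP => _; rewrite ?mulr1 ?mulr0 addr0.
Qed.

Lemma control_cost_lex_optimal eps : 0 <= eps ->
  exists mu q f t,
    lex_optimal (target M' p) decided (@stage_cost _ _ M N N0 p eps) mu q f t.
Proof.
move=> e0; apply: lex_optimal_exists.
- exact: target_decided.
- exact: decided_absorbing.
- exact: undecided_hits_expand.
- by move=> x a; exact: stage_cost_ge0.
- exact: stage_cost_decided.
Qed.

Lemma control_cost_is_min eps mu q f t : 0 <= eps ->
  lex_optimal (target M' p) decided (@stage_cost _ _ M N N0 p eps) mu q f t ->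
  is_min [set control_cost M N0 p eps pi | pi in Xi M N0 p] (f (init M'))%:E.
Proof.
move=> e0 opt; apply: stationary_is_min opt => //.
- exact: target_decided.
- exact: decided_absorbing.
- by move=> x a; exact: stage_cost_ge0.
Qed.

End expanded_mdp.

Theorem theorem1 (R : realType) (AP : Type) (M : mdp R AP) (N : nat)
    (N0 : (0 < N)%N) (p : AP) (s0_undecided : init M \in undecided M p)
    (epsbar : R) (epsbar_gt0 : 0 < epsbar) :
  exists eps : R, 0 < eps /\
  exists m_eps m_0 : \bar R,
    [/\ is_min [set control_cost M N0 p eps pi | pi in Xi M N0 p] m_eps,
        is_min [set control_cost M N0 p 0 pi | pi in Xi M N0 p] m_0
      & (m_eps <= m_0 + epsbar%:E)%E].
Proof.
have [mu [q [f [t opt0]]]] := control_cost_lex_optimal M N0 p (lexx 0).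
set x0 := init (expand_absorb M N0 p).
have t0 : 0 <= t x0 := lex_t_ge0 opt0 x0.
(* Chosen so that [eps * t x0 <= epsbar]; the added 1 keeps the denominator positive. *)
pose eps := epsbar / (t x0 + 1).
have eps_gt0 : 0 < eps by rewrite divr_gt0// ltr_wpDl.
have [mu' [q' [f' [t' opt']]]] := control_cost_lex_optimal M N0 p (ltW eps_gt0).
exists eps; split=> //; exists (f' x0)%:E, (f x0)%:E; split.
- exact: control_cost_is_min (ltW eps_gt0) opt'.
- exact: control_cost_is_min (lexx 0) opt0.
(* The optimal rule for cost parameter 0 competes in the problem for [eps], since membership in [Xi]
   does not depend on the cost. *)
have [_ /(_ (control_cost M N0 p eps (stationary opt0)))] :=
  control_cost_is_min (ltW eps_gt0) opt'.
move=> /(_ _)/le_trans; apply.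
  exists (stationary opt0) => //; apply: stationary_optimal.
  - exact: target_decided.
  - exact: decided_absorbing.
(* The function [f + eps * t] solves the evaluation equation of this rule for the cost with
   [eps]. *)
apply: le_trans
  (stationary_total_cost (h := fun x => f x + eps * t x) opt0 _ _ _) _.
- by move=> x a; exact: stage_cost_ge0 (ltW eps_gt0).
- move=> x; rewrite addr_ge0 ?(lex_f_ge0 opt0)// mulr_ge0 ?(lex_t_ge0 opt0)//.
  exact: ltW.
- move=> x; rewrite stage_costD; last exact: lex_avail opt0 x.
  have -> : mean x (mu x) (fun y => f y + eps * t y) =
      mean x (mu x) f + eps * mean x (mu x) t.
    by rewrite /mean mulr_sumr -big_split; apply: eq_bigr => y _ /=; ring.
  by rewrite [in LHS](lex_f_mu opt0) [in LHS](lex_t_mu opt0); ring.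
rewrite -EFinD lee_fin lerD2l /eps -mulrA ler_piMr ?ltW//.
by rewrite mulrC ltr_pdivrMr ?ltr_wpDl// mul1r ltrDl.
Qed.
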